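(* Let $P=(X,\prec)$ be a poset on $|X|\ge 2$ elements and fix a nonempty subset $A\subseteq X$. Let $f$ be a uniformly random linear extension of $P$ and let $f_{\min}(A):=\min\{f(a):a\in A\}$. Then $$\mathbb{P}[f_{\min}(A)>1]^2\ \ge\ \mathbb{P}[f_{\min}(A)>2]$$ and $$\mathbb{P}[f_{\min}(A)=1]\cdot\mathbb{P}[f_{\min}(A)>1]\ \le\ \mathbb{P}[f_{\min}(A)=2].$$
   Context: A linear extension of a poset $P=(X,\prec)$ with $|X|=n$ is a bijection $f:X\to\{1,\dots,n\}$ such that $u\prec v$ implies $f(u)<f(v)$. Probabilities are with respect to the uniform distribution on the set of linear extensions of $P$. *)

(* Defs.v *)
From mathcomp Require Import all_boot all_order all_algebra.

Set Implicit Arguments.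
Unset Strict Implicit.
Unset Printing Implicit Defensive.

Import Order.TTheory GRing.Theory Num.Theory.

Section LinearExtensions.

Variables (d : Order.disp_t) (X : finPOrderType d).

(* {1, ..., n} is encoded as 'I_n through i |-> i.+1. *)
Definition bijectiveb (f : {ffun X -> 'I_#|X|}) : bool :=
  injectiveb f && [forall i, exists x, f x == i].

Definition lin_ext : {set {ffun X -> 'I_#|X|}} :=
  [set f | bijectiveb f &&
           [forall u, forall v, (u < v)%O ==> (f u < f v)%N]].

Definition pos (f : {ffun X -> 'I_#|X|}) (x : X) : nat := (f x).+1.

(* The default value #|X| is an upper bound of pos f, so for A nonempty this
   is the minimum of pos f over A. *)
Definition fmin (A : {set X}) (f : {ffun X -> 'I_#|X|}) : nat :=
  \big[minn/#|X|]_(a in A) pos f a.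

Definition Pr (E : pred {ffun X -> 'I_#|X|}) : rat :=
  (#|[set f in lin_ext | E f]|%:R / #|lin_ext|%:R)%R.

End LinearExtensions.

(* Main.v *)
Require Import Defs.
From mathcomp Require Import all_boot all_order all_algebra.
From mathcomp Require Import zify.

Set Implicit Arguments.
Unset Strict Implicit.
Unset Printing Implicit Defensive.

Import Order.TTheory GRing.Theory Num.Theory.

(* Let e(S) be the number of linear extensions of the poset induced on S.  For
   distinct minimal elements a, b one has e(X-a) e(X-b) <= e(X) e(X-a-b).
   Summing over the minimal a in A and b outside A bounds
   #(f_min = 1) #(f_min > 1) by e(X) times the number of linear extensions that
   start with some b outside A followed by some a in A, all of which have
   f_min = 2.  The first inequality is a rearrangement of the second.

   The inequality for a, b is an instance, for the dual order, of Fishburn's: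
     e(U) e(V) / (|U|! |V|!) <= e(J) e(M) / (|J|! |M|!)
   for lower sets U and V with union J and intersection M.  Multiplied by
   (|U| + |V|)!, the two sides count the linear extensions of the disjoint sums
   U + V and J + M, and the former inject into the latter.  Given a linear
   extension of U + V, link x < y when some copy of y comes before the other
   copy of x; missing copies are taken to come last.  Exchanging the two copies
   of every element of a union of connected components preserves the order and
   the links.  Doing so for the components that meet V \ U yields a linear
   extension of J + M, and the links allow the exchange to be undone. *)

Section LinearExtensions.

Variables (T : finType) (r : rel T).
Implicit Types (S U V : {set T}) (p : seq T) (E : pred (seq T)).

Definition linexts S : seq (seq T) :=
  [seq p <- permutations (enum S) | pairwise (fun x y => ~~ r y x) p].

Definition nb_linexts S := size (linexts S).

Definition minimal S x := (x \in S) && [forall y in S :\ x, ~~ r y x].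

Definition lower S := forall x y, r x y -> y \in S -> x \in S.

Lemma minimalD1 S x y : x != y -> minimal S x -> minimal (S :\ y) x.
Proof.
rewrite /minimal !inE => -> /andP[-> /forall_inP xmin] /=.
by apply/forall_inP => z; rewrite setDDl setUC -setDDl => /setD1P[_ /xmin].
Qed.

Lemma lowerU U V : lower U -> lower V -> lower (U :|: V).
Proof.
move=> lowU lowV x y rxy; rewrite !inE.
by case/orP => [/(lowU _ _ rxy)->|/(lowV _ _ rxy)->]; rewrite ?orbT.
Qed.

Lemma lowerI U V : lower U -> lower V -> lower (U :&: V).
Proof.
move=> lowU lowV x y rxy; rewrite !inE.
by case/andP => /(lowU _ _ rxy)-> /(lowV _ _ rxy)->.
Qed.

Lemma linexts_uniq S : uniq (linexts S).
Proof. exact/filter_uniq/permutations_uniq. Qed.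

Lemma linextsP S p :
  reflect [/\ uniq p, p =i S & pairwise (fun x y => ~~ r y x) p]
          (p \in linexts S).
Proof.
rewrite mem_filter mem_permutations andbC.
apply: (iffP andP) => [[pS ?]|[up pS ?]]; split=> //.
- by rewrite (perm_uniq pS) enum_uniq.
- by move=> x; rewrite (perm_mem pS) mem_enum.
- by apply: uniq_perm (enum_uniq _) _ => // x; rewrite mem_enum pS.
Qed.

(* For x not in p, index x p is size p: missing elements count as last. *)
Lemma lower_linextsP S p : lower S ->
  reflect [/\ uniq p, p =i S & forall x y, r x y -> index x p <= index y p]
          (p \in linexts S).
Proof.
move=> lowS; apply: (iffP (linextsP S p)) => -[up pS r_p]; split=> //.
- move=> x y rxy; rewrite leqNgt; apply/negP => yx.
  have yp : y \in p by rewrite -index_mem (leq_trans yx) ?index_size.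
  have xp : x \in p by rewrite pS (lowS _ _ rxy) -?pS.
  have /(pairwiseP x)/(_ _ _ _ _ yx) := r_p.
  by rewrite !inE !index_mem !nth_index // rxy => /(_ yp xp).
- case Dp: p => [//|x0 q]; rewrite -Dp; apply/(pairwiseP x0) => i j ip jp ij.
  by apply/negP => /r_p; rewrite !index_uniq // leqNgt ij.
Qed.

Lemma cons_linexts S x p :
  (x :: p \in linexts S) = minimal S x && (p \in linexts (S :\ x)).
Proof.
apply/linextsP/andP => [[/= /andP[xp up] pS /andP[/allP xmin ?]]|].
  have pSx : p =i S :\ x.
    move=> y; rewrite !inE -pS inE.
    by case: eqVneq => [->|]; rewrite ?(negbTE xp).
  split; last exact/linextsP.
  rewrite /minimal -pS mem_head.
  by apply/forall_inP => y; rewrite -pSx; apply: xmin.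
case=> /andP[xS /forall_inP xmin] /linextsP[up pSx ?].
split=> [|y|] /=; first by rewrite pSx !inE eqxx.
  by rewrite inE pSx !inE; case: eqVneq => [->|].
by apply/andP; split=> //; apply/allP => y; rewrite pSx; apply: xmin.
Qed.

Lemma perm_linexts_cons S : S != set0 ->
  perm_eq (linexts S)
          [seq x :: p | x <- enum (minimal S), p <- linexts (S :\ x)].
Proof.
move=> S0; apply: uniq_perm (linexts_uniq S) _ _.
  apply: allpairs_uniq_dep => [|x _|]; rewrite ?enum_uniq ?linexts_uniq //.
  by move=> [x p] [y q] _ _ /= [-> ->].
move=> [|x p]; apply/idP/allpairsPdep => [|[y [q [] //]]].
- case/linextsP => _ S0E _; case/negP: S0.
  by apply/eqP/setP => x; rewrite -S0E !inE.
- by rewrite cons_linexts => /andP[? ?]; exists x, p; rewrite mem_enum.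
- by rewrite mem_enum cons_linexts => ? ? [-> ->]; apply/andP.
Qed.

Lemma count_linexts S E : S != set0 ->
  count E (linexts S) =
    \sum_(x | minimal S x) count (fun p => E (x :: p)) (linexts (S :\ x)).
Proof.
move=> /perm_linexts_cons/permP->.
rewrite count_flatten -map_comp sumnE big_map big_enum.
by apply: eq_bigr => x _; rewrite /= count_map.
Qed.

Lemma leq_count_linexts S E :
  \sum_(x | minimal S x) count (fun p => E (x :: p)) (linexts (S :\ x)) <=
    count E (linexts S).
Proof.
have [->|S0] := eqVneq S set0; last by rewrite count_linexts.
by rewrite big_pred0 // => x; rewrite /minimal inE.
Qed.

Lemma nb_linexts0 : nb_linexts set0 = 1.
Proof. by rewrite /nb_linexts /linexts enum_set0. Qed.

Lemma nb_linextsE S : S != set0 ->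
  nb_linexts S = \sum_(x | minimal S x) nb_linexts (S :\ x).
Proof. by move=> S0; rewrite /nb_linexts -count_predT count_linexts. Qed.

End LinearExtensions.

Lemma pairwise_rev (T : Type) (r : rel T) (p : seq T) :
  pairwise r (rev p) = pairwise (fun x y => r y x) p.
Proof.
by elim: p => //= x p IHp; rewrite rev_cons pairwise_rcons all_rev IHp.
Qed.

Lemma nb_linexts_dual (T : finType) (r : rel T) (S : {set T}) :
  nb_linexts (fun x y => r y x) S = nb_linexts r S.
Proof.
have rev_inj : injective (@rev T) := can_inj revK.
rewrite /nb_linexts -[RHS](size_map rev); apply/perm_size/uniq_perm => [||p].
- exact: linexts_uniq.
- by rewrite (map_inj_uniq rev_inj) linexts_uniq.
rewrite -[p in RHS]revK (mem_map rev_inj).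
by apply/linextsP/linextsP; rewrite rev_uniq pairwise_rev => -[up pS ?];
  split=> // x; rewrite -pS mem_rev.
Qed.

Lemma leq_bin2r_half n m k : n <= m.*2 -> m <= k -> 'C(n, k) <= 'C(n, m).
Proof.
move=> nm; elim: k => [|k IHk]; first by rewrite leqn0 => /eqP->.
rewrite leq_eqVlt ltnS => /predU1P[-> //|mk]; apply: leq_trans (IHk mk).
rewrite -(leq_pmul2l (ltn0Sn k)) mul_bin_left leq_mul2r.
by apply/orP; right; lia.
Qed.

Section TwoCopies.

Variables (T : finType) (r : rel T).
Implicit Types (U V C : {set T}) (w : seq (T * bool)).

Definition copies_rel : rel (T * bool) :=
  fun k l => (k.2 == l.2) && r k.1 l.1.

Definition two_copies U V : {set T * bool} :=
  [set l | l.1 \in if l.2 then U else V].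

Lemma minimal_copies U V x s :
  minimal copies_rel (two_copies U V) (x, s) = minimal r (if s then U else V) x.
Proof.
rewrite /minimal inE; congr (_ && _); apply/forall_inP/forall_inP => xmin.
  move=> y yS; have := xmin (y, s); rewrite !inE /copies_rel /= eqxx; apply.
  by move: yS; rewrite !inE xpair_eqE eqxx andbT.
move=> [y t]; rewrite !inE xpair_eqE /copies_rel /=.
by have [-> /=|//] := eqVneq t s; rewrite andbT -in_setD1; apply: xmin.
Qed.

Lemma two_copiesD1 U V x s :
  two_copies U V :\ (x, s) =
    if s then two_copies (U :\ x) V else two_copies U (V :\ x).
Proof.
by apply/setP => -[y t]; rewrite !inE xpair_eqE; case: s t => -[];
  rewrite !inE /= ?andbT ?andbF ?inE.
Qed.

Lemma nb_linexts_copiesE U V : (U != set0) || (V != set0) ->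
  nb_linexts copies_rel (two_copies U V) =
    \sum_(x | minimal r U x) nb_linexts copies_rel (two_copies (U :\ x) V) +
    \sum_(x | minimal r V x) nb_linexts copies_rel (two_copies U (V :\ x)).
Proof.
move=> UV0; rewrite nb_linextsE; last first.
  case/orP: UV0 => /set0Pn[x xS]; apply/set0Pn;
  by [exists (x, true); rewrite inE | exists (x, false); rewrite inE].
pose F x s := if minimal copies_rel (two_copies U V) (x, s)
              then nb_linexts copies_rel (two_copies U V :\ (x, s)) else 0.
transitivity (\sum_l F l.1 l.2).
  by rewrite big_mkcond; apply: eq_bigr => -[].
rewrite -(pair_bigA _ F) /F /=.
under eq_bigr do rewrite big_bool !minimal_copies !two_copiesD1.
by rewrite big_split -!big_mkcond.
Qed.

Lemma nb_linexts_copies U V :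
  nb_linexts copies_rel (two_copies U V) =
    'C(#|U| + #|V|, #|U|) * (nb_linexts r U * nb_linexts r V).
Proof.
have [n] := ubnP (#|U| + #|V|); elim: n U V => // n IHn U V UVn.
have sumU : U != set0 ->
    \sum_(x | minimal r U x) nb_linexts copies_rel (two_copies (U :\ x) V) =
    'C(#|U|.-1 + #|V|, #|U|.-1) * (nb_linexts r U * nb_linexts r V).
  move=> /nb_linextsE->; rewrite big_distrl big_distrr /=.
  apply: eq_bigr => x /andP[xU _]; have UE := cardsD1 x U; rewrite xU in UE.
  by rewrite IHn ?UE //; lia.
have sumV : V != set0 ->
    \sum_(x | minimal r V x) nb_linexts copies_rel (two_copies U (V :\ x)) =
    'C(#|U| + #|V|.-1, #|U|) * (nb_linexts r U * nb_linexts r V).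
  move=> /nb_linextsE->; rewrite !big_distrr /=.
  apply: eq_bigr => x /andP[xV _]; have VE := cardsD1 x V; rewrite xV in VE.
  by rewrite IHn ?VE //; lia.
have minimal0 x : minimal r set0 x = false by rewrite /minimal inE.
have [U0|U0] := eqVneq U set0; have [V0|V0] := eqVneq V set0.
- have -> : two_copies U V = set0.
    by apply/setP => -[x s]; rewrite U0 V0 !inE if_same inE.
  by rewrite U0 V0 !nb_linexts0 !cards0.
- rewrite nb_linexts_copiesE ?V0 ?orbT // sumV //.
  by rewrite U0 (eq_bigl _ _ minimal0) big_pred0_eq cards0 !bin0.
- rewrite nb_linexts_copiesE ?U0 // sumU //.
  by rewrite V0 (eq_bigl _ _ minimal0) big_pred0_eq cards0 !addn0 !binn.
rewrite nb_linexts_copiesE ?U0 // sumU // sumV // -mulnDl.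
move: U0 V0; rewrite -!card_gt0; case: #|U| => // i; case: #|V| => // j _ _.
by rewrite /= !addnS addSn binS addnC.
Qed.

Definition index_monotone w :=
  forall x y s, r x y -> index (x, s) w <= index (y, s) w.

Lemma linexts_copiesP U V w : lower r U -> lower r V ->
  reflect [/\ uniq w, w =i two_copies U V & index_monotone w]
          (w \in linexts copies_rel (two_copies U V)).
Proof.
move=> lowU lowV; apply: (iffP (lower_linextsP _ _)) => [-[x s] [y t]||].
- rewrite /copies_rel !inE /= => /andP[/eqP-> rxy].
  by case: t; [apply: lowU | apply: lowV].
- case=> uw wUV w_mono; split=> // x y s rxy; apply: w_mono.
  by rewrite /copies_rel eqxx.
case=> uw wUV w_mono; split=> // -[x s] [y t] /andP[/eqP/= -> ].
exact: w_mono.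
Qed.

Definition crossing w : rel T :=
  fun x y => r x y && [exists s, index (y, ~~ s) w < index (x, s) w].

Definition linked w : rel T := fun x y => crossing w x y || crossing w y x.

Lemma linked_connect_sym w : connect_sym (linked w).
Proof. by apply: sym_connect_sym => x y; rewrite /linked orbC. Qed.

Definition swap_copies C (l : T * bool) : T * bool :=
  (l.1, l.2 (+) (l.1 \in C)).

Lemma swap_copiesK C : involutive (swap_copies C).
Proof. by case=> x s; rewrite /swap_copies /= -addbA addbb addbF. Qed.

Lemma swap_copies_inj C : injective (swap_copies C).
Proof. exact/inv_inj/swap_copiesK. Qed.

Lemma mem_swap_two_copies U V C l : V :\: U \subset C -> C :&: U \subset V ->
  (swap_copies C l \in two_copies U V) =
    (l \in two_copies (U :|: V) (U :&: V)).
Proof.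
move=> /subsetP VUC /subsetP CUV; case: l => x s.
have /implyP := CUV x; have /implyP := VUC x; rewrite !inE /=.
by case: s; rewrite !inE; case: (x \in C); case: (x \in U); case: (x \in V).
Qed.

Lemma index_swap_copies C w l :
  index l (map (swap_copies C) w) = index (swap_copies C l) w.
Proof.
by rewrite -{1}[l](swap_copiesK C) index_map //; apply: swap_copies_inj.
Qed.

Section SwapClosed.

Variables (C : {set T}) (w : seq (T * bool)).
Hypotheses (C_closed : closed (linked w) C) (w_mono : index_monotone w).

Lemma uncrossed_index x y s :
  r x y -> (x \in C) != (y \in C) -> index (x, s) w <= index (y, ~~ s) w.
Proof.
move=> rxy; apply: contraNT; rewrite -ltnNge => yx; apply/eqP/C_closed.
by rewrite /linked /crossing rxy; apply/orP; left; apply/existsP; exists s.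
Qed.

Lemma swap_index_monotone : index_monotone (map (swap_copies C) w).
Proof.
move=> x y s rxy; rewrite !index_swap_copies /swap_copies /=.
have [<-|xyC] := eqVneq (x \in C) (y \in C); first exact: w_mono.
have /addbP<- : (x \in C) (+) (y \in C) by rewrite -negb_eqb.
by rewrite addbN uncrossed_index.
Qed.

Lemma crossing_swap : crossing (map (swap_copies C) w) =2 crossing w.
Proof.
move=> x y; rewrite /crossing; case: (boolP (r x y)) => //= rxy.
have [xyC|xyC] := eqVneq (x \in C) (y \in C).
  apply/existsP/existsP => -[s lt_yx]; exists (s (+) (x \in C)); move: lt_yx;
  rewrite !index_swap_copies /swap_copies /= -xyC addNb //.
  by rewrite -addbA addbb addbF.
transitivity false; [|symmetry]; apply/negbTE/existsPn => s; rewrite -leqNgt.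
- rewrite !index_swap_copies /swap_copies /=.
  have /addbP<- : (x \in C) (+) (y \in C) by rewrite -negb_eqb.
  by rewrite addNb addbN negbK w_mono.
- exact: uncrossed_index.
Qed.

End SwapClosed.

Section Fishburn.

Variables U V : {set T}.
Hypotheses (lowU : lower r U) (lowV : lower r V).

Definition swap_set w : {set T} := [set x in closure (linked w) (V :\: U)].

Definition uncross w := map (swap_copies (swap_set w)) w.

Lemma swap_set_closed w : closed (linked w) (swap_set w).
Proof.
have V_closed := closure_closed (linked_connect_sym w) (mem (V :\: U)).
by move=> x y /V_closed; rewrite !inE.
Qed.

Lemma setD_sub_swap_set w : V :\: U \subset swap_set w.
Proof. by apply/subsetP => x xD; rewrite inE mem_closure. Qed.

Lemma swap_setI_sub w : w \in linexts copies_rel (two_copies U V) ->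
  swap_set w :&: U \subset V.
Proof.
case/linexts_copiesP => // _ wUV w_mono.
(* Holds on V :\: U, where (y, true) is missing, and fails on U :\: V. *)
pose false_first := [pred y | index (y, false) w <= index (y, true) w].
have first_closed : closed (linked w) false_first.
  apply: intro_closed; first exact: linked_connect_sym.
  move=> y z /orP[] /andP[r_yz /existsP[[] /= lt_yz]]; rewrite !inE => y_first.
  - exact: leq_trans (ltnW lt_yz) (w_mono _ _ true r_yz).
  - by have := leq_trans y_first (w_mono _ _ true r_yz); rewrite leqNgt lt_yz.
  - exact: leq_trans (w_mono _ _ false r_yz) (ltnW lt_yz).
  - by have := leq_trans (w_mono _ _ false r_yz) y_first; rewrite leqNgt lt_yz.
apply/subsetP => x /setIP[]; rewrite inE.
case/pred0Pn => y /andP[/= xy /setDP[yV yU]] xU.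
have y_first : y \in false_first.
  by rewrite inE (memNindex (_ : (y, true) \notin w)) ?index_size // wUV inE.
have xw : (x, true) \in w by rewrite wUV inE.
suff : (x, false) \in w by rewrite wUV inE.
rewrite -!index_mem in xw *; apply: leq_ltn_trans xw.
by move: y_first; rewrite -(closed_connect first_closed xy) inE.
Qed.

Lemma uncross_linexts w : w \in linexts copies_rel (two_copies U V) ->
  uncross w \in linexts copies_rel (two_copies (U :|: V) (U :&: V)).
Proof.
move=> w_lin; have [//|//|uw wUV w_mono] := linexts_copiesP _ _ _ w_lin.
apply/linexts_copiesP; [exact: lowerU | exact: lowerI | split].
- by rewrite map_inj_uniq //; apply: swap_copies_inj.
- move=> l; rewrite -index_mem size_map index_swap_copies index_mem wUV.
  by rewrite mem_swap_two_copies ?setD_sub_swap_set ?swap_setI_sub.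
- exact: swap_index_monotone (@swap_set_closed w) w_mono.
Qed.

Lemma swap_set_uncross w : w \in linexts copies_rel (two_copies U V) ->
  swap_set (uncross w) = swap_set w.
Proof.
case/linexts_copiesP => // _ _ w_mono.
have linkedE : linked (uncross w) =2 linked w.
  by move=> x y; rewrite /linked !(crossing_swap (@swap_set_closed w) w_mono).
apply/setP => x; rewrite !inE; congr (~~ _); apply: eq_disjoint => y.
exact: (eq_connect linkedE).
Qed.

Lemma uncross_inj :
  {in linexts copies_rel (two_copies U V) &, injective uncross}.
Proof.
move=> w1 w2 w1_lin w2_lin eq_w; have := eq_w.
rewrite /uncross -(swap_set_uncross w1_lin) eq_w swap_set_uncross //.
exact/inj_map/swap_copies_inj.
Qed.

Lemma fishburn_inequality :
  'C(#|U| + #|V|, #|U|) * (nb_linexts r U * nb_linexts r V) <=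
  'C(#|U| + #|V|, #|U :|: V|) *
    (nb_linexts r (U :|: V) * nb_linexts r (U :&: V)).
Proof.
rewrite -[X in _ <= 'C(X, _) * _]cardsUI -!nb_linexts_copies /nb_linexts.
rewrite -(size_map uncross); apply: uniq_leq_size.
  by rewrite (map_inj_in_uniq uncross_inj) linexts_uniq.
by move=> _ /mapP[w w_lin ->]; apply: uncross_linexts.
Qed.

Lemma nb_linexts_log_supermodular :
  nb_linexts r U * nb_linexts r V <=
  nb_linexts r (U :|: V) * nb_linexts r (U :&: V).
Proof.
have binUV : 'C(#|U| + #|V|, #|U :|: V|) <= 'C(#|U| + #|V|, #|U|).
  have [VU|/ltnW UV] := leqP #|V| #|U|.
    by rewrite leq_bin2r_half ?subset_leq_card ?subsetUl // -addnn leq_add2l.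
  rewrite -(bin_sub (leq_addr _ _)) addKn.
  by rewrite leq_bin2r_half ?subset_leq_card ?subsetUr // -addnn leq_add2r.
have := leq_trans fishburn_inequality (leq_mul binUV (leqnn _)).
by rewrite leq_pmul2l // bin_gt0 leq_addr.
Qed.

End Fishburn.

End TwoCopies.

Lemma nb_linexts_minimal_log_supermodular (T : finType) (r : rel T) a b :
    a != b -> minimal r setT a -> minimal r setT b ->
  nb_linexts r (setT :\ a) * nb_linexts r (setT :\ b) <=
  nb_linexts r setT * nb_linexts r (setT :\ a :\ b).
Proof.
move=> ab amin bmin.
have lowerD1 x : minimal r setT x -> lower (fun y z => r z y) (setT :\ x).
  case/andP => _ /forall_inP xmin y z rzy; rewrite !inE !andbT => zx.
  by apply: contraL rzy => /eqP->; apply: xmin; rewrite !inE zx.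
have := nb_linexts_log_supermodular (lowerD1 _ amin) (lowerD1 _ bmin).
rewrite !(nb_linexts_dual r) -setDUr -setDIr setDDl.
rewrite (_ : [set a] :&: [set b] = set0) ?setD0 //.
by apply/disjoint_setI0; rewrite disjoints1 inE.
Qed.

Lemma count_leq_split (T : Type) (g : T -> nat) k (s : seq T) :
  count (fun x => k <= g x) s =
    count (fun x => g x == k) s + count (fun x => k < g x) s.
Proof. by elim: s => //= x s ->; case: ltngtP => _ /=; lia. Qed.

Section FirstHit.

Variables (T : finType) (r : rel T) (A : {set T}).
Implicit Types (S : {set T}) (p : seq T).

Lemma count_find0 S : S != set0 ->
  count (fun p => find (mem A) p == 0) (linexts r S) =
    \sum_(a | minimal r S a && (a \in A)) nb_linexts r (S :\ a).
Proof.
move=> S0; rewrite count_linexts // [RHS]big_mkcondr; apply: eq_bigr => a _ /=.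
by case: (a \in A); rewrite ?count_predT ?count_pred0.
Qed.

Lemma count_find_gt0 S : S != set0 ->
  count (fun p => 0 < find (mem A) p) (linexts r S) =
    \sum_(b | minimal r S b && (b \notin A)) nb_linexts r (S :\ b).
Proof.
move=> S0; rewrite count_linexts // [RHS]big_mkcondr; apply: eq_bigr => b _ /=.
by case: (b \in A); rewrite ?count_predT ?count_pred0.
Qed.

Lemma leq_count_find1 S :
  \sum_(b | minimal r S b && (b \notin A))
    \sum_(a | minimal r S a && (a \in A)) nb_linexts r (S :\ b :\ a) <=
  count (fun p => find (mem A) p == 1) (linexts r S).
Proof.
apply: leq_trans (leq_count_linexts _ _ _); rewrite big_mkcondr.
apply: leq_sum => b bmin /=; case: ifPn => [bA|//]; rewrite (negbTE bA).
apply: leq_trans (leq_count_linexts _ _ _).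
rewrite [leqLHS]big_mkcond [leqRHS]big_mkcond.
apply: leq_sum => a _ /=; case: ifP => [/andP[amin aA]|//].
by rewrite minimalD1 ?aA ?count_predT //; apply: contraNneq bA => <-.
Qed.

Lemma count_find_correlation : A != set0 ->
  count (fun p => find (mem A) p == 0) (linexts r setT) *
  count (fun p => 0 < find (mem A) p) (linexts r setT) <=
  nb_linexts r setT * count (fun p => find (mem A) p == 1) (linexts r setT).
Proof.
move=> A0; have T0 : [set: T] != set0.
  by apply: contraNneq A0 => T0; rewrite -subset0 -T0 subsetT.
apply: leq_trans (leq_mul (leqnn _) (leq_count_find1 setT)).
rewrite count_find0 // count_find_gt0 // mulnC big_distrlr big_distrr /=.
apply: leq_sum => b /andP[bmin bA]; rewrite big_distrr /=.
apply: leq_sum => a /andP[amin aA].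
apply: nb_linexts_minimal_log_supermodular => //.
by apply: contraNneq bA => ->.
Qed.

Lemma count_find_log_concave : A != set0 ->
  nb_linexts r setT * count (fun p => 1 < find (mem A) p) (linexts r setT) <=
  count (fun p => 0 < find (mem A) p) (linexts r setT) ^ 2.
Proof.
move=> /count_find_correlation; rewrite /nb_linexts -count_predT.
rewrite (count_leq_split (find (mem A)) 0) (count_leq_split (find (mem A)) 1).
nia.
Qed.

End FirstHit.

Section RandomLinearExtension.

Variables (d : Order.disp_t) (X : finPOrderType d).
Implicit Types (A : {set X}) (p : seq X) (f : {ffun X -> 'I_#|X|}).

Local Notation words := (linexts (<%O : rel X) setT).

(* The default value is never taken when p lists all of X. *)
Definition ranking p : {ffun X -> 'I_#|X|} :=
  [ffun x => insubd (enum_rank x) (index x p)].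

Lemma wordsP p :
  reflect [/\ uniq p, p =i X & forall x y, (x < y)%O -> index x p <= index y p]
          (p \in words).
Proof.
have lowX : lower (<%O : rel X) setT by move=> x y _; rewrite !inE.
by apply: (iffP (lower_linextsP p lowX)) => -[up pX p_mono]; split=> // x;
  rewrite pX !inE.
Qed.

Lemma rankingE p x : p \in words -> ranking p x = index x p :> nat.
Proof.
case/wordsP => /card_uniqP up pX _; rewrite ffunE insubdK //.
by rewrite unfold_in -(eq_card pX) up index_mem pX.
Qed.

Lemma ranking_inj : {in words &, injective ranking}.
Proof.
move=> p q pw qw eq_pq.
have [up pX _] := wordsP _ pw; have [uq qX _] := wordsP _ qw.
have eq_index x : index x p = index x q by rewrite -!rankingE // eq_pq.
have eq_size : size p = size q.
  by rewrite -!(card_uniqP _) // (eq_card pX) (eq_card qX).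
case Dp: p => [|x0 s]; first by apply/esym/nilP; rewrite /nilp -eq_size Dp.
rewrite -{}Dp; apply: (@eq_from_nth _ x0) => // i ip.
by rewrite -[i in RHS](index_uniq x0 ip up) eq_index nth_index // qX.
Qed.

Lemma lin_extP f :
  reflect (injective f /\ forall x y, (x < y)%O -> f x < f y) (f \in lin_ext X).
Proof.
rewrite inE -andbA; apply: (iffP and3P) => [[/injectiveP fi _ f_mono]|].
  by split=> // x y; have /forallP/(_ x)/forallP/(_ y)/implyP := f_mono.
case=> fi f_mono; split; first exact/injectiveP.
  apply/forallP => i; apply/existsP.
  by have /codomP[x ->] := inj_card_onto fi (eq_leq (card_ord _)) i; exists x.
by apply/forallP => x; apply/forallP => y; apply/implyP/f_mono.
Qed.

Lemma lin_ext_ranking : lin_ext X =i [seq ranking p | p <- words].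
Proof.
move=> f; apply/lin_extP/mapP => [[fi f_mono]|[p pw ->]].
  have [g fK gK] := inj_card_bij fi (eq_leq (card_ord _)).
  pose p := [seq g i | i <- enum 'I_#|X|].
  have index_p x : index x p = f x.
    by rewrite -[x in LHS]fK index_map ?index_enum_ord //; apply: can_inj gK.
  suff pw : p \in words.
    by exists p => //; apply/ffunP => x; apply/val_inj; rewrite /= rankingE.
  apply/wordsP; split.
  - by rewrite map_inj_uniq ?enum_uniq //; apply: can_inj gK.
  - by move=> x; rewrite -index_mem index_p size_map size_enum_ord ltn_ord.
  - by move=> x y xy; rewrite !index_p ltnW ?f_mono.
have [_ pX p_mono] := wordsP _ pw.
have index_p_inj : injective (fun x => index x p).
  by move=> x y; apply: (index_inj x); rewrite pX.
split=> [x y /(congr1 val)|x y xy]; rewrite /= !rankingE //.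
  exact: index_p_inj.
by rewrite ltn_neqAle p_mono ?(inj_eq index_p_inj) ?lt_eqF.
Qed.

Lemma card_lin_ext (E : pred {ffun X -> 'I_#|X|}) :
  #|[set f in lin_ext X | E f]| = count (fun p => E (ranking p)) words.
Proof.
rewrite -count_map -size_filter -(card_uniqP _).
  by apply: eq_card => f; rewrite inE mem_filter lin_ext_ranking andbC.
by rewrite filter_uniq // (map_inj_in_uniq ranking_inj) linexts_uniq.
Qed.

Lemma fmin_ranking A p : A != set0 -> p \in words ->
  fmin A (ranking p) = (find (mem A) p).+1.
Proof.
case/set0Pn => a0 a0A pw; have [up pX _] := wordsP _ pw.
have hasA : has (mem A) p by apply/hasP; exists a0; rewrite ?pX.
pose a := nth a0 p (find (mem A) p).
have aA : a \in A by apply: (nth_find a0 hasA).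
have index_a : index a p = find (mem A) p by rewrite index_uniq // -has_find.
rewrite /fmin -minEnat; apply/le_anti/andP; split.
  by apply: (bigmin_inf a) => [//|]; rewrite /pos rankingE // index_a.
apply/bigmin_geP; split=> [|b bA]; rewrite leEnat.
  by rewrite -(eq_card pX) (card_uniqP up) -has_find.
rewrite /pos rankingE // ltnS leqNgt; apply/negP => /(before_find a0).
by rewrite nth_index ?pX //= bA.
Qed.

Lemma Pr_fmin A (E : pred nat) : A != set0 ->
  Pr (fun f => E (fmin A f)) =
    ((count (fun p => E (find (mem A) p).+1) words)%:R / (size words)%:R)%R.
Proof.
move=> A0; rewrite /Pr card_lin_ext; congr (_%:R / _%:R)%R.
  by apply: eq_in_count => p pw; rewrite fmin_ranking.
rewrite -count_predT -(card_lin_ext predT).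
by apply: eq_card => f; rewrite inE andbT.
Qed.

End RandomLinearExtension.

Theorem theorem1p6 (d : Order.disp_t) (X : finPOrderType d)
    (hX : (2 <= #|X|)%N) (A : {set X}) (hA : A != set0) :
  (Pr (fun f => (2 < fmin A f)%N) <= Pr (fun f => (1 < fmin A f)%N) ^+ 2)%R
  /\ (Pr (fun f => fmin A f == 1%N) * Pr (fun f => (1 < fmin A f)%N)
      <= Pr (fun f => fmin A f == 2%N))%R.
Proof.
have correlation := count_find_correlation (<%O : rel X) hA.
have log_concave := count_find_log_concave (<%O : rel X) hA.
rewrite (Pr_fmin (ltn 2) hA) (Pr_fmin (ltn 1) hA).
rewrite (Pr_fmin (pred1 1) hA) (Pr_fmin (pred1 2) hA) /=.
have [->|n_gt0] := posnP (size (linexts (<%O : rel X) setT)).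
  by rewrite invr0 !mulr0 expr0n.
split.
- rewrite expr_div_n ler_pdivlMr ?exprn_gt0 ?ltr0n // expr2 mulrA divfK.
    by rewrite -natrM -natrX ler_nat mulnC; exact: log_concave.
  by rewrite pnatr_eq0 -lt0n.
- rewrite mulrA ler_pM2r ?invr_gt0 ?ltr0n // mulrAC ler_pdivrMr ?ltr0n //.
  by rewrite -!natrM ler_nat [leqRHS]mulnC; exact: correlation.
Qed.
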